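(* Let $y_1(k),\dots,y_n(k)\in\mathbb{R}^q$ ($n\ge 2$) be the measurements of a cluster at time $k$, with positive definite noise covariance matrices $R_1(k),\dots,R_n(k)\in\mathbb{R}^{q\times q}$. Let $(y_f^s(k),R_f^s(k))$ be the fused measurement and noise covariance produced by sequential measurement fusion (SMF), and $(y_f^b(k),R_f^b(k))$ those produced by batch measurement fusion (BMF), both as defined in the context. Then the SMF is equivalent to the BMF, i.e. $$y_f^s(k)=y_f^b(k)\qquad\text{and}\qquad R_f^s(k)=R_f^b(k).$$
   Context: Measurements: $y_i(k)=C(k)x(k)+\upsilon_i(k)$, $i=1,\dots,n$, where $x(k)$ is the system state, $C(k)$ a common measurement matrix, and $\upsilon_i(k)$ are zero-mean, mutually uncorrelated noises with covariances $R_i(k)$. SMF: set $y_{(0)}(k)=y_1(k)$, $R_{(0)}(k)=R_1(k)$, and for $j=1,\dots,n-1$ $$R_{(j)}(k)=\left[R_{(j-1)}^{-1}(k)+R_{j+1}^{-1}(k)\right]^{-1},\qquad y_{(j)}(k)=R_{(j)}(k)\left[R_{(j-1)}^{-1}(k)y_{(j-1)}(k)+R_{j+1}^{-1}(k)y_{j+1}(k)\right];$$ then $y_f^s(k)=y_{(n-1)}(k)$ and $R_f^s(k)=R_{(n-1)}(k)$. BMF: $$R_f^b(k)=\left[\sum_{i=1}^n R_i^{-1}(k)\right]^{-1},\qquad y_f^b(k)=R_f^b(k)\left[\sum_{i=1}^n R_i^{-1}(k)y_i(k)\right].$$ *)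

(* Defs.v *)
(* Sensors are numbered 1, ..., n.  A family indexed by the sensors is a function
   on nat of which only the values at 1, ..., n matter. *)
From mathcomp Require Export all_boot all_order all_algebra.
From mathcomp Require Export all_classical all_reals all_analysis.

Set Implicit Arguments.
Unset Strict Implicit.
Unset Printing Implicit Defensive.

Import Order.TTheory GRing.Theory Num.Theory.

Local Open Scope ring_scope.

Definition posdefmx (R : realType) (q : nat) (A : 'M[R]_q) : Prop :=
  A^T = A /\ forall u : 'cV[R]_q, u != 0 -> 0 < (u^T *m A *m u) ord0 ord0.

Section NoiseModel.
Variables (d : measure_display) (T : measurableType d) (R : realType).
Variables (P : probability T R) (n q : nat).

(* The noises at one fixed time.  [covariance] is an extended-real integral; it
   is meaningful here because the components are square integrable. *)
Definition uncorrelated_noises (v : nat -> T -> 'cV[R]_q)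
    (Rc : nat -> 'M[R]_q) : Prop :=
  [/\ forall i, (1 <= i <= n)%N ->
        forall a, (fun w => v i w a ord0) \in Lfun P 2%:E,
      forall i, (1 <= i <= n)%N ->
        forall a, 'E_P[fun w => v i w a ord0]%E = 0%E,
      forall i, (1 <= i <= n)%N ->
        forall a b, covariance P (fun w => v i w a ord0)
                      (fun w => v i w b ord0) = (Rc i a b)%:E
    & forall i j, (1 <= i <= n)%N -> (1 <= j <= n)%N -> i != j ->
        forall a b, covariance P (fun w => v i w a ord0)
                      (fun w => v j w b ord0) = 0%E].

End NoiseModel.

(* [invmx] returns its argument unchanged on a singular matrix; every matrix
   inverted below is positive definite when the covariances are. *)
Section Fusion.
Variables (R : realType) (q : nat).
Variables (Rc : nat -> 'M[R]_q) (y : nat -> 'cV[R]_q).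

(* R_(j) and y_(j): step j = j' + 1 incorporates sensor j + 1 = j' + 2. *)
Fixpoint smf_cov (j : nat) : 'M[R]_q :=
  if j is j'.+1 then invmx (invmx (smf_cov j') + invmx (Rc j'.+2))
  else Rc 1%N.

Fixpoint smf_meas (j : nat) : 'cV[R]_q :=
  if j is j'.+1 then
    smf_cov j *m (invmx (smf_cov j') *m smf_meas j'
                  + invmx (Rc j'.+2) *m y j'.+2)
  else y 1%N.

Variable n : nat.

Definition smf_fused_cov : 'M[R]_q := smf_cov n.-1.
Definition smf_fused_meas : 'cV[R]_q := smf_meas n.-1.

Definition bmf_fused_cov : 'M[R]_q :=
  invmx (\sum_(1 <= i < n.+1) invmx (Rc i)).
Definition bmf_fused_meas : 'cV[R]_q :=
  bmf_fused_cov *m \sum_(1 <= i < n.+1) (invmx (Rc i) *m y i).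

End Fusion.

(* Main.v *)
(* In information form the fusion is additive: induction on j gives
   R_(j)^-1 = R_1^-1 + ... + R_(j+1)^-1 and
   R_(j)^-1 y_(j) = R_1^-1 y_1 + ... + R_(j+1)^-1 y_(j+1).
   Positive definiteness makes every R_(j)^-1 invertible, so the case j = n - 1
   is the batch formula. *)
Require Import Defs.

Import Order.TTheory GRing.Theory Num.Theory.

Local Open Scope ring_scope.

(** A singular [A] would kill a nonzero row [u], and its quadratic form would vanish at [u^T]. *)
Lemma posdefmx_unit {R : realType} {q : nat} {A : 'M[R]_q} :
  posdefmx A -> A \in unitmx.
Proof.
move=> [_ Apos]; rewrite unitmxE unitfE; apply/det0P => -[u u0 uA0].
have := Apos u^T; rewrite trmx_eq0 trmxK uA0 mul0mx mxE ltxx.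
by move/(_ u0).
Qed.

(** Substituting [u = A *m z], the form of [invmx A] at [u] equals the form of [A] at [z], by
    symmetry of [A]. *)
Lemma posdefmx_inv {R : realType} {q : nat} {A : 'M[R]_q} :
  posdefmx A -> posdefmx (invmx A).
Proof.
move=> Apd; have Au := posdefmx_unit Apd; case: Apd => Asym Apos.
split=> [|u u0]; first by rewrite trmx_inv Asym.
have Bu0 : invmx A *m u != 0.
  by apply: contraNneq u0 => Bu0; rewrite -(mulKVmx Au u) Bu0 mulmx0.
by have := Apos _ Bu0; rewrite trmx_mul trmx_inv Asym mulmxKV// mulmxA.
Qed.

Lemma posdefmxD {R : realType} {q : nat} {A B : 'M[R]_q} :
  posdefmx A -> posdefmx B -> posdefmx (A + B).
Proof.
move=> [Asym Apos] [Bsym Bpos]; split=> [|u u0].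
  by rewrite linearD /= Asym Bsym.
by rewrite mulmxDr mulmxDl mxE addr_gt0 ?Apos ?Bpos.
Qed.

Section SequentialFusion.
Context {R : realType} {q n : nat}.
Context {Rc : nat -> 'M[R]_q} (y : nat -> 'cV[R]_q).
Hypothesis Rc_posdef : forall i, (1 <= i <= n)%N -> posdefmx (Rc i).

Lemma posdefmx_smf_cov {j : nat} : (j < n)%N -> posdefmx (smf_cov Rc j).
Proof.
elim: j => [|j IHj] jn /=; first exact: Rc_posdef.
by apply/posdefmx_inv/posdefmxD; apply: posdefmx_inv;
  [exact/IHj/ltnW|exact: Rc_posdef].
Qed.

Lemma invmx_smf_cov (j : nat) :
  invmx (smf_cov Rc j) = \sum_(1 <= i < j.+2) invmx (Rc i).
Proof.
elim: j => [|j IHj]; first by rewrite big_nat1.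
(* [invmx] is an involution on all matrices, as it fixes the singular ones, so the two outer
   inverses cancel outright. *)
by rewrite big_nat_recr//= invmxK IHj.
Qed.

Lemma invmx_smf_cov_meas {j : nat} : (j < n)%N ->
  invmx (smf_cov Rc j) *m smf_meas Rc y j =
  \sum_(1 <= i < j.+2) (invmx (Rc i) *m y i).
Proof.
elim: j => [|j IHj] jn; first by rewrite big_nat1.
rewrite big_nat_recr// -IHj ?(ltnW jn)//.
(* Here a true inverse is required: the leading factor [smf_cov Rc j.+1] of the measurement cancels
   against its [invmx]. *)
exact: mulKmx (posdefmx_unit (posdefmx_smf_cov jn)) _.
Qed.

End SequentialFusion.

Theorem theorem2 (d : measure_display) (T : measurableType d) (R : realType)
    (P : probability T R) (n p q : nat)
    (x : nat -> T -> 'cV[R]_p) (C : nat -> 'M[R]_(q, p))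
    (v y : nat -> nat -> T -> 'cV[R]_q) (Rc : nat -> nat -> 'M[R]_q) (k : nat)
    (hn : (2 <= n)%N)
    (hnoise : uncorrelated_noises P n (fun i => v i k) (fun i => Rc i k))
    (hy : forall i, (1 <= i <= n)%N ->
            forall w : T, y i k w = C k *m x k w + v i k w)
    (hR : forall i, (1 <= i <= n)%N -> posdefmx (Rc i k)) :
  forall w : T,
    smf_fused_meas (fun i => Rc i k) (fun i => y i k w) n
      = bmf_fused_meas (fun i => Rc i k) (fun i => y i k w) n
    /\ smf_fused_cov (fun i => Rc i k) n = bmf_fused_cov (fun i => Rc i k) n.
Proof.
move=> w; case: n hn {hnoise hy} hR => // m _ hRm.
have cov_eq : smf_cov (Rc ^~ k) m = bmf_fused_cov (Rc ^~ k) m.+1.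
  by rewrite /bmf_fused_cov -invmx_smf_cov invmxK.
split; last exact: cov_eq.
have covU := posdefmx_unit (posdefmx_smf_cov hRm (ltnSn m)).
rewrite /bmf_fused_meas -cov_eq.
(* Read from right to left, the batch sum becomes the last sequential measurement times its inverse
   covariance, which the outer covariance undoes. *)
rewrite -(invmx_smf_cov_meas (fun i => y i k w) hRm (ltnSn m)).
by rewrite mulKVmx.
Qed.
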